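(* Let $\Omega$ be a non-empty set, let $\lambda:\Omega\to[0,1]$ be a possibility distribution on $\Omega$, and let $P_\lambda$ be the possibility measure induced by $\lambda$. Let $\delta\in(0,2)$. Suppose that the sequence of functions $X_k:\Omega\to\mathbb{R}$, $k\in\mathbb{N}=\{1,2,\dots\}$, satisfies $$\sum_{k=1}^{\infty}\frac{Var_{sup}(X_k)}{k^\delta}<+\infty.$$ Denote $M_n(\omega)=\max\{X_1(\omega),\dots,X_n(\omega)\}$, $\omega\in\Omega$. Then $Y_n(\omega):=\frac{M_n(\omega)-E_{sup}(M_n)}{n}$ converges to $0$ as $n\to\infty$, almost everywhere with respect to $P_\lambda$; that is, $$P_\lambda\left(\left\{\omega\in\Omega:\frac{M_n(\omega)-E_{sup}(M_n)}{n}\not\to 0\right\}\right)=0,$$ and also $$P_\lambda\left(\left\{\omega\in\Omega:\lim_{n\to\infty}\frac{M_n(\omega)-E_{sup}(M_n)}{n}=0\right\}\right)=1.$$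
   Context: A possibility distribution on a non-empty set $\Omega$ is a function $\lambda:\Omega\to[0,1]$ with $\sup\{\lambda(s):s\in\Omega\}=1$. It induces the possibility measure $P_\lambda:\mathcal{P}(\Omega)\to[0,1]$ (defined on all subsets of $\Omega$) given by $P_\lambda(A)=\sup\{\lambda(s):s\in A\}$ for $A\subset\Omega$, with $P_\lambda(\emptyset)=0$. For a function $X:\Omega\to\mathbb{R}$, the possibility expectation is $E_{sup}(X)=\sup_{s\in\Omega}X(s)\lambda(s)$, and the possibility variance is $Var_{sup}(X)=\sup\{(X(s)-E_{sup}(X))^2\lambda(s):s\in\Omega\}$. The possibility variance is defined for $X$ with $E_{sup}(X)$ finite, so the assumed condition on the $Var_{sup}(X_k)$ is understood to include that each $E_{sup}(X_k)$ and each $Var_{sup}(X_k)$ is a finite real number. Functions $Y_n:\Omega\to\mathbb{R}$ converge to $Y:\Omega\to\mathbb{R}$ almost everywhere with respect to $P_\lambda$ if $P_\lambda(\{\omega\in\Omega:Y_n(\omega)\not\to Y(\omega)\})=0$, where $Y_n(\omega)\not\to Y(\omega)$ means that $(Y_n(\omega))_n$ either has no limit or has a limit different from $Y(\omega)$. *)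

(* Defs.v *)
From HB Require Import structures.
From mathcomp Require Import all_boot all_order all_algebra.
From mathcomp Require Import all_classical all_reals all_analysis.
Set Implicit Arguments.
Unset Strict Implicit.
Unset Printing Implicit Defensive.
Import Order.TTheory GRing.Theory Num.Theory.
Import numFieldNormedType.Exports.
Local Open Scope classical_set_scope.
Local Open Scope ring_scope.

Definition possibility_distribution (R : realType) (Omega : Type)
    (lambda : Omega -> R) : Prop :=
  (forall s, 0 <= lambda s <= 1) /\ sup (range lambda) = 1.

(* The real supremum satisfies [sup set0 = 0], which is the convention
   P_lambda(empty) = 0; lambda being bounded, no other junk value occurs. *)
Definition possibility_measure (R : realType) (Omega : Type)
    (lambda : Omega -> R) (A : set Omega) : R :=
  sup (lambda @` A).

Definition Esup (R : realType) (Omega : Type) (lambda : Omega -> R)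
    (X : Omega -> R) : \bar R :=
  ereal_sup (range (fun s => (X s * lambda s)%:E)).

(* Meaningful only when [Esup lambda X] is a finite number. *)
Definition Varsup (R : realType) (Omega : Type) (lambda : Omega -> R)
    (X : Omega -> R) : \bar R :=
  ereal_sup (range (fun s => ((X s - fine (Esup lambda X)) ^+ 2 * lambda s)%:E)).

Definition possibility_ae_cvg (R : realType) (Omega : Type)
    (lambda : Omega -> R) (Y : nat -> Omega -> R) (Z : Omega -> R) : Prop :=
  possibility_measure lambda
    [set w | ~ ((fun n => Y n w) @ \oo --> Z w)] = 0.

(* max {X_1, ..., X_n} for n >= 1: the sequence is indexed from 1, so [X 0] is
   never used, and the default value [X 1] is neutral as soon as n >= 1. *)
Definition running_max (R : realType) (Omega : Type) (X : nat -> Omega -> R)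
    (n : nat) (w : Omega) : R :=
  \big[Num.max/X 1%N w]_(1 <= k < n.+1) X k w.

(* Hence [fine (Esup lambda (running_max X n))] is the actual expectation. *)
Lemma Esup_running_max_fin_num (R : realType) (Omega : Type)
    (lambda : Omega -> R) (X : nat -> Omega -> R) (n : nat) :
  possibility_distribution lambda ->
  (forall k, (1 <= k)%N -> Esup lambda (X k) \is a fin_num) ->
  Esup lambda (running_max X n) \is a fin_num.
Proof.
move=> [l01 supl] EX.
have [w0] : exists w : Omega, True.
  apply: contrapT => noW; have : range lambda = set0.
    by apply/seteqP; split => // x [w _ _]; case: noW; exists w.
  by move=> e; move: supl; rewrite e sup0 => /eqP; rewrite eq_sym oner_eq0.
move=> _.
have ltE k s : (1 <= k)%N -> X k s * lambda s <= fine (Esup lambda (X k)).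
  move=> k1; rewrite -lee_fin fineK ?EX//.
  by apply: ereal_sup_ubound; exists s.
have [B lB] : exists B, forall k, (1 <= k < n.+2)%N ->
    fine (Esup lambda (X k)) <= B.
  elim: n.+2 => [|m [B IHm]]; first by exists 0 => k; rewrite ltn0 andbF.
  exists (Num.max B (fine (Esup lambda (X m)))) => k /andP[k1].
  rewrite ltnS leq_eqVlt le_max => /predU1P[->|km]; first by rewrite lexx orbT.
  by rewrite IHm// k1.
have MB s : running_max X n s * lambda s <= B.
  rewrite /running_max big_nat; apply: (big_ind (fun x => x * lambda s <= B)).
  - exact: le_trans (ltE 1%N s _) (lB _ _).
  - by move=> x y xB yB; rewrite maxEle; case: ifP.
  - move=> k /andP[k1 kn].
    by apply: le_trans (ltE k s k1) (lB _ _); rewrite k1 ltnW.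
rewrite fin_real//; apply/andP; split.
  apply: (@lt_le_trans _ _ (running_max X n w0 * lambda w0)%:E).
    exact: ltNyr.
  by apply: ereal_sup_ubound; exists w0.
apply: (@le_lt_trans _ _ B%:E); last exact: ltry.
by apply: ge_ereal_sup => _ [s _ <-]; rewrite lee_fin.
Qed.

(* Main.v *)
(** Write e_k = E_sup(X_k) and v_k = Var_sup(X_k). Since lambda >= 0, E_sup
    commutes with finite maxima, so E_sup(M_n) = max_(k <= n) e_k. If S is the
    sum of the series, each of its terms is at most S, i.e. v_k <= S k^delta;
    so at a point w with lambda(w) > 0 and for k <= n,
    |X_k(w) - e_k| <= sqrt(v_k / lambda(w)) <= sqrt(S n^delta / lambda(w)).
    The maximum is 1-Lipschitz for the sup norm, so M_n(w) - E_sup(M_n) obeys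
    the same bound, which is o(n) because delta < 2. Hence Y_n converges to 0
    at every w with lambda(w) > 0. *)
Require Import Defs.
From HB Require Import structures.
From mathcomp Require Import all_boot all_order all_algebra.
From mathcomp Require Import all_classical all_reals all_analysis.
From mathcomp Require Import lra.
Set Implicit Arguments.
Unset Strict Implicit.
Unset Printing Implicit Defensive.
Import Order.TTheory GRing.Theory Num.Theory.
Import numFieldNormedType.Exports.
Local Open Scope classical_set_scope.
Local Open Scope ring_scope.

Lemma ler_norm_maxB (R : realDomainType) (b x1 x2 y1 y2 : R) :
  `|x1 - y1| <= b -> `|x2 - y2| <= b ->
  `|Num.max x1 x2 - Num.max y1 y2| <= b.
Proof.
rewrite !ler_norml => /andP[? ?] /andP[? ?].
by case: (leP x1 x2) => ?; case: (leP y1 y2) => ?; apply/andP; split; lra.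
Qed.

(** Multiplication by [lambda s >= 0] distributes over the maximum, and a supremum of pointwise
    maxima is the maximum of the suprema. *)
Lemma Esup_max (R : realType) (Omega : Type) (lambda : Omega -> R)
    (X Y : Omega -> R) :
  (forall s, 0 <= lambda s) ->
  Esup lambda (fun s => Num.max (X s) (Y s)) =
  maxe (Esup lambda X) (Esup lambda Y).
Proof.
move=> l0; have E s : (Num.max (X s) (Y s) * lambda s)%:E =
    maxe (X s * lambda s)%:E (Y s * lambda s)%:E.
  by rewrite maxr_pMl// EFin_max.
apply/eqP; rewrite eq_le; apply/andP; split.
  apply: ge_ereal_sup => _ [s _ <-]; rewrite E ge_max !le_max.
  by apply/andP; split; apply/orP; [left|right];
    apply: ereal_sup_ubound; exists s.
by rewrite ge_max; apply/andP; split; apply: ge_ereal_sup => _ [s _ <-];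
  apply: le_ereal_sup_tmp;
  exists (maxe (X s * lambda s)%:E (Y s * lambda s)%:E);
  rewrite ?le_max ?lexx ?orbT//; exists s.
Qed.

Lemma Esup_bigmax (R : realType) (Omega I : Type) (lambda : Omega -> R)
    (r : seq I) (X0 : Omega -> R) (X : I -> Omega -> R) :
  (forall s, 0 <= lambda s) ->
  Esup lambda (fun s => \big[Num.max/X0 s]_(i <- r) X i s) =
  \big[maxe/Esup lambda X0]_(i <- r) Esup lambda (X i).
Proof.
move=> l0; elim: r => [|i r IHr].
  by rewrite big_nil; congr (Esup _ _); apply/funext => s; rewrite big_nil.
rewrite big_cons -IHr -Esup_max//; congr (Esup _ _).
by apply/funext => s; rewrite big_cons.
Qed.

Lemma fine_Esup_running_max (R : realType) (Omega : Type)
    (lambda : Omega -> R) (X : nat -> Omega -> R) (n : nat) :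
  (forall s, 0 <= lambda s) ->
  (forall k, (1 <= k)%N -> Esup lambda (X k) \is a fin_num) ->
  fine (Esup lambda (running_max X n)) =
  \big[Num.max/fine (Esup lambda (X 1%N))]_(1 <= k < n.+1)
    fine (Esup lambda (X k)).
Proof.
move=> l0 Xfin; rewrite Esup_bigmax// !big_nat.
(* [fine] respects maxima only on finite values, so the induction runs in the extended reals on the
   relation [x = y%:E]. *)
apply: (congr1 fine (_ : _ = _%:E)).
apply: (big_ind2 (fun x y => x = y%:E)) => [|_ x _ y -> ->|k /andP[k1 _]].
- by rewrite fineK// Xfin.
- by rewrite EFin_max.
- by rewrite fineK// Xfin.
Qed.

Lemma Varsup_ge (R : realType) (Omega : Type) (lambda X : Omega -> R) s :
  Varsup lambda X \is a fin_num ->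
  (X s - fine (Esup lambda X)) ^+ 2 * lambda s <= fine (Varsup lambda X).
Proof.
by move=> Vfin; rewrite -lee_fin fineK//; apply: ereal_sup_ubound; exists s.
Qed.

Lemma Varsup_ge0 (R : realType) (Omega : Type) (lambda X : Omega -> R) :
  [set: Omega] !=set0 -> (forall s, 0 <= lambda s) ->
  (0 <= Varsup lambda X)%E.
Proof.
move=> [s _] l0; apply: le_ereal_sup_tmp.
exists ((X s - fine (Esup lambda X)) ^+ 2 * lambda s)%:E; first by exists s.
by rewrite lee_fin mulr_ge0// sqr_ge0.
Qed.

Lemma cvg_natV_powR (R : realType) (a : R) : 0 < a ->
  (n%:R^-1) `^ a @[n --> \oo] --> (0 : R).
Proof.
(* The shift skips n = 0, where the inverse is 0: the right-hand limit at 0 needs a positive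
   sequence. *)
move=> a0; rewrite -(cvg_shiftS (fun n => (n%:R^-1 : R) `^ a)).
have /cvg_at_rightP := powR_cvg0 a0.
by apply; split => [n|]; [rewrite invr_gt0 ltr0n|exact: cvg_harmonic].
Qed.

Lemma possibility_measure_eq0 (R : realType) (Omega : Type)
    (lambda : Omega -> R) (A : set Omega) :
  (forall s, A s -> lambda s = 0) -> possibility_measure lambda A = 0.
Proof.
move=> A0; rewrite /possibility_measure.
have [->|/set0P [s As]] := eqVneq A set0; first by rewrite image_set0 sup0.
suff -> : lambda @` A = [set 0] by rewrite sup1.
apply/seteqP; split => [_ [t At <-]|_ ->]; first exact: A0.
by exists s => //; exact: A0.
Qed.

(** Points outside [A] have [lambda = 0], so dropping them does not lower the supremum, once some
    point of positive possibility is known to lie in [A]. *)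
Lemma possibility_measure_eq1 (R : realType) (Omega : Type)
    (lambda : Omega -> R) (A : set Omega) :
  possibility_distribution lambda ->
  (forall s, 0 < lambda s -> A s) -> possibility_measure lambda A = 1.
Proof.
move=> [l01 supl] A1; rewrite /possibility_measure.
have ubl B : has_ubound (lambda @` B).
  by exists 1 => _ [s _ <-]; case/andP: (l01 s).
have [w lw] : exists w, 0 < lambda w.
  apply: contrapT => nl; suff sup0 : sup (range lambda) = 0.
    by move/eqP: supl; rewrite sup0 eq_sym oner_eq0.
  apply: (@possibility_measure_eq0 _ _ lambda setT) => s _; apply/eqP.
  rewrite eq_le; case/andP: (l01 s) => -> _; rewrite andbT leNgt.
  by apply/negP => ls; apply: nl; exists s.
apply/eqP; rewrite eq_le; apply/andP; split.
  apply: ge_sup; first by exists (lambda w), w => //; exact: A1.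
  by move=> _ [s _ <-]; case/andP: (l01 s).
rewrite -supl; apply: ge_sup; first by exists (lambda w), w.
move=> _ [s _ <-]; have [ls|ls] := ltP 0 (lambda s).
  by apply: ub_le_sup => //; exists s => //; exact: A1.
(* Here [s] may lie outside [A], but [w] lies in [A] and [lambda s <= 0 < lambda w]. *)
apply: le_trans ls (le_trans (ltW lw) _).
by apply: ub_le_sup => //; exists w => //; exact: A1.
Qed.

Theorem theorem3p5 (R : realType) (Omega : Type)
    (Omega0 : [set: Omega] !=set0)
    (lambda : Omega -> R) (lambdaP : possibility_distribution lambda)
    (delta : R) (delta02 : 0 < delta < 2)
    (X : nat -> Omega -> R)
    (EX_fin : forall k, (1 <= k)%N -> Esup lambda (X k) \is a fin_num)
    (VarX_fin : forall k, (1 <= k)%N -> Varsup lambda (X k) \is a fin_num)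
    (VarX_sum : (\sum_(1 <= k <oo)
       (Varsup lambda (X k) * ((k%:R `^ delta)^-1)%:E) < +oo)%E) :
  let M := running_max X in
  let Y := fun n w => (M n w - fine (Esup lambda (M n))) / n%:R in
  [/\ possibility_ae_cvg lambda Y (fun=> 0),
      possibility_measure lambda
        [set w | ~ ((fun n => Y n w) @ \oo --> (0 : R))] = 0 &
      possibility_measure lambda
        [set w | (fun n => Y n w) @ \oo --> (0 : R)] = 1].
Proof.
move=> M Y; have l0 s : 0 <= lambda s by case/andP: (lambdaP.1 s).
set S := (\sum_(1 <= k <oo) _)%E in VarX_sum.
have V0 k : (0 <= Varsup lambda (X k))%E by exact: Varsup_ge0.
have term0 k : (0 <= Varsup lambda (X k) * ((k%:R `^ delta)^-1)%:E)%E.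
  by rewrite mule_ge0// lee_fin invr_ge0 powR_ge0.
have S0 : (0 <= S)%E by exact: nneseries_ge0.
have Sfin : S \is a fin_num by rewrite ge0_fin_numE.
have VleS k : (1 <= k)%N ->
    fine (Varsup lambda (X k)) <= fine S * k%:R `^ delta.
  move=> k1; rewrite -ler_pdivrMr ?powR_gt0 ?ltr0n//.
  rewrite -lee_fin fineK// EFinM fineK ?VarX_fin//.
  (* The term of index k is the last one of the partial sum over 1 <= i < k.+1. *)
  apply: le_trans (nneseries_lim_ge k.+1 (fun i _ _ => term0 i)).
  by rewrite big_nat_recr//= leeDr// sume_ge0.
have Y_cvg w : 0 < lambda w -> Y n w @[n --> \oo] --> (0 : R).
  move=> lw.
  (* The bound uses n instead of k so as to be uniform over the functions entering the maximum. *)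
  have dist k n : (1 <= k <= n)%N ->
      `|X k w - fine (Esup lambda (X k))| <=
      Num.sqrt (fine S / lambda w * n%:R `^ delta).
    move=> /andP[k1 kn]; rewrite -sqrtr_sqr ler_wsqrtr// mulrAC.
    rewrite ler_pdivlMr// (le_trans (Varsup_ge _ (VarX_fin _ k1)))//.
    apply: le_trans (VleS _ k1) _.
    rewrite ler_wpM2l ?fine_ge0// ge0_ler_powR ?nnegrE ?ler_nat//.
    by case/andP: delta02 => /ltW.
  have Y_le n : (0 < n)%N -> `|Y n w| <=
      Num.sqrt (fine S / lambda w * (n%:R^-1) `^ (2 - delta)).
    move=> n0; have n0R : 0 < n%:R :> R by rewrite ltr0n.
    (* The factor 1 / n of [Y] enters the square root as 1 / n^2, leaving a positive power of 1 /
       n. *)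
    have -> : (n%:R^-1 : R) `^ (2 - delta) = n%:R `^ delta / n%:R ^+ 2.
      rewrite -powR_inv1 ?ler0n// -powRrM mulN1r opprB powRB ?powR_mulrn ?ler0n//.
      by rewrite (gt_eqF n0R) implybT.
    rewrite mulrA sqrtrM ?mulr_ge0 ?powR_ge0 ?invr_ge0 ?fine_ge0//.
    rewrite sqrtrV ?sqr_ge0// sqrtr_sqr /Y normrM normfV.
    rewrite ler_pM2r ?invr_gt0 ?normr_gt0 ?gt_eqF//.
    rewrite /M fine_Esup_running_max// /running_max.
    (* Both maxima are built in parallel; their default values are compared by [dist] at k = 1,
       hence the need for n > 0. *)
    rewrite !big_nat; apply: (big_ind2 (fun x y => `|x - y| <= _)).
    - by apply: dist; rewrite n0.
    - by move=> *; exact: ler_norm_maxB.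
    - by move=> k; rewrite ltnS; exact: dist.
  apply/norm_cvg0P.
  apply: (@squeeze_cvgr _ _ _ _ (fun=> 0) (fun n =>
      Num.sqrt (fine S / lambda w * (n%:R^-1) `^ (2 - delta)))).
  - by exists 1%N => // n /= n1; rewrite normr_ge0 Y_le.
  - exact: cvg_cst.
  - rewrite -[X in _ --> X]sqrtr0; apply: continuous_cvg.
      exact: sqrt_continuous.
    rewrite -[X in _ --> X](mulr0 (fine S / lambda w)); apply: cvgMr.
    by apply: cvg_natV_powR; rewrite subr_gt0; case/andP: delta02.
have Y0 : possibility_measure lambda
    [set w | ~ ((fun n => Y n w) @ \oo --> (0 : R))] = 0.
  apply: possibility_measure_eq0 => w /= nY.
  (* By contraposition, divergence at [w] forces [lambda w = 0]. *)
  by apply: contra_notP nY => /eqP lw; apply: Y_cvg; rewrite lt_def lw l0.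
by split=> //; exact: possibility_measure_eq1.
Qed.
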